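(* Let $(R,\mathfrak m)$ be a commutative Noetherian local ring satisfying $\mathfrak m^4=0$ and $\mathfrak m^3\neq 0$, and let $M$ be a finitely generated $R$-module whose minimal free resolution is eventually linear. If $\operatorname{Ext}_R^i(M,R)=0$ for all $i\gg 0$, then the Betti sequence $\{b_i(M)\}_{i\ge 0}$ of $M$ is not eventually periodic of period two or three.
   Context: Write $k=R/\mathfrak m$. The Betti numbers of $M$ are $b_n(M)=\dim_k\operatorname{Tor}_n^R(M,k)$, i.e. the ranks of the free modules in the minimal free resolution of $M$; the Betti sequence is $\{b_i(M)\}_{i\ge 0}$. ''Eventually periodic of period $p$'' means that there is $N$ such that the sequence $\{b_i\}_{i\ge N}$ is periodic with (least) period equal to $p$; an eventually constant sequence has period one. Eventually linear: Let $\mathbf F=(F_i,\partial_i)$ be the minimal free resolution of $M$. The associated graded complex is $\operatorname{gr}_{\mathfrak m}(\mathbf F)=\bigoplus_{j\in\mathbb Z}\operatorname{gr}_{\mathfrak m}(\mathbf F)^j$, where $\operatorname{gr}_{\mathfrak m}(\mathbf F)^j$ is the complex whose $i$-th term is $\mathfrak m^{j-i}F_i/\mathfrak m^{j-i+1}F_i$ and whose differentials $\mathfrak m^{j-i}F_i/\mathfrak m^{j-i+1}F_i\to \mathfrak m^{j-i+1}F_{i-1}/\mathfrak m^{j-i+2}F_{i-1}$ are induced by $\partial_i$ (convention: $\mathfrak m^n=R$ for $n\le 0$). The linearity defect of $M$ is $\operatorname{ld}_R(M)=\inf\{n\in\mathbb N\mid \operatorname H_i(\operatorname{gr}_{\mathfrak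 m}(\mathbf F))=0\text{ for all } i\ge n\}$. The resolution $\mathbf F$ is eventually linear if $\operatorname{ld}_R(M)$ is finite and positive. *)

(* Defs.v *)
From HB Require Import structures.
From mathcomp Require Import all_boot all_order all_algebra.
From mathcomp Require Import boolp classical_sets.

Set Implicit Arguments.
Unset Strict Implicit.
Unset Printing Implicit Defensive.

Import GRing.Theory.
Local Open Scope classical_set_scope.
Local Open Scope ring_scope.

Section Rings.
Variable R : comNzRingType.

Definition ideal (I : set R) : Prop := submod_closed [in (I : set R^o)].

(* [idealr_closed] describes the proper ideals. *)
Definition maximal_ideal (I : set R) : Prop :=
  idealr_closed [in I] /\
  forall J : set R, idealr_closed [in J] -> I `<=` J -> J = I.

Definition local_ring (m : set R) : Prop :=
  maximal_ideal m /\ forall n : set R, maximal_ideal n -> n = m.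

Definition noetherian : Prop :=
  forall I : set R, ideal I ->
  exists (n : nat) (g : 'I_n -> R),
    I = [set x | exists a : 'I_n -> R, x = \sum_(i < n) a i * g i].

Definition fin_gen (M : lmodType R) : Prop :=
  exists (n : nat) (g : 'I_n -> M),
    forall x : M, exists a : 'I_n -> R, x = \sum_(i < n) a i *: g i.

Definition smul (I : set R) (V : lmodType R) (N : set V) : set V :=
  [set x | exists (n : nat) (a : 'I_n -> R) (v : 'I_n -> V),
     [/\ forall i, I (a i), forall i, N (v i) &
         x = \sum_(i < n) a i *: v i]].

Fixpoint idealX (I : set R) (n : nat) : set R :=
  if n is n'.+1 then @smul I R^o (idealX I n') else setT.

Definition idealXz (I : set R) (n : int) : set R :=
  match n with Posz k => idealX I k | Negz _ => setT end.

(* The submodule I^n V of V. *)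
Definition filt (I : set R) (n : int) {V : lmodType R} : set V :=
  smul (idealXz I n) setT.

End Rings.

(* Resolutions by free modules of finite rank, with chosen bases:
   F_i = 'rV[R]_(rank F i) and diff F i : F_(i+1) -> F_i. *)
Record free_resolution (R : comNzRingType) (M : lmodType R) := FreeResolution {
  rank : nat -> nat;
  diff : forall i : nat, {linear 'rV[R]_(rank i.+1) -> 'rV[R]_(rank i)};
  aug : {linear 'rV[R]_(rank 0) -> M};
  aug_surj : range aug = setT;
  aug_exact : aug @^-1` [set 0] = range (diff 0);
  diff_exact : forall i : nat, diff i @^-1` [set 0] = range (diff i.+1)
}.

Section Resolutions.
Variables (R : comNzRingType) (M : lmodType R).
Implicit Types (m : set R) (F : free_resolution M).

Definition minimal m F : Prop :=
  forall i : nat, range (diff F i) `<=` smul m setT.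

(* Meaningful for a minimal resolution of M over a local ring, where rank F i
   is the dimension of Tor_i(M, k) over the residue field k. *)
Definition betti F : nat -> nat := rank F.

(* Vanishing of Ext^i(M, N), the i-th cohomology of the complex Hom(F, N). *)
Definition cocycle F (N : lmodType R) (i : nat)
    (f : {linear 'rV[R]_(rank F i) -> N}) : Prop :=
  forall y, f (diff F i y) = 0.

Definition coboundary F (N : lmodType R) (i : nat) :
    {linear 'rV[R]_(rank F i) -> N} -> Prop :=
  match i with
  | 0%N => fun f => forall x, f x = 0
  | i'.+1 => fun f => exists g : {linear 'rV[R]_(rank F i') -> N},
      forall x, f x = g (diff F i' x)
  end.

Definition Ext_eq0 F (N : lmodType R) (i : nat) : Prop :=
  forall f : {linear 'rV[R]_(rank F i) -> N}, cocycle f -> coboundary f.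

(* The i-th term of gr_m(F)^j is m^(j-i) F_i / m^(j-i+1) F_i.  The two sets
   below are the preimages in F_i of its cycles and of its boundaries, so the
   homology vanishes when the former is contained in the latter; the other
   inclusion holds for every minimal F. *)
Definition gr_cycle m F (i : nat) (j : int) : set 'rV[R]_(rank F i) :=
  match i with
  | 0%N => filt m j
  | i'.+1 => [set x | filt m (j - i'.+1%:Z) x /\
                      filt m (j - i'.+1%:Z + 2) (diff F i' x)]
  end.

Definition gr_boundary m F (i : nat) (j : int) : set 'rV[R]_(rank F i) :=
  [set x | exists y z, [/\ filt m (j - i%:Z - 1) y,
                           filt m (j - i%:Z + 1) z & x = diff F i y + z]].

Arguments gr_cycle : clear implicits.
Arguments gr_boundary : clear implicits.

Definition gr_homology_eq0 m F (i : nat) : Prop :=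
  forall j : int, gr_cycle m F i j `<=` gr_boundary m F i j.

(* ld(M) = n; there is no such n when ld(M) is infinite. *)
Definition linearity_defect_is m F (n : nat) : Prop :=
  (forall i : nat, (n <= i)%N -> gr_homology_eq0 m F i) /\
  (forall n' : nat,
     (forall i : nat, (n' <= i)%N -> gr_homology_eq0 m F i) -> (n <= n')%N).

Definition eventually_linear m F : Prop :=
  exists n : nat, (0 < n)%N /\ linearity_defect_is m F n.

End Resolutions.

Definition periodic_from (b : nat -> nat) (N p : nat) : Prop :=
  (0 < p)%N /\ forall i : nat, (N <= i)%N -> b (i + p)%N = b i.

(* p is the least period of the tail. *)
Definition eventually_periodic (b : nat -> nat) (p : nat) : Prop :=
  exists N : nat, periodic_from b N p /\
    forall q : nat, periodic_from b N q -> (p <= q)%N.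

(* Main.v *)
(* A strand of gr_m(F) in high homological degree is a bounded exact complex of
   vector spaces over k = R/m, whose terms are sums of copies of m^a/m^(a+1).
   With d_a = dim_k m^a/m^(a+1), counting dimensions gives, for large i,
     d_0 b_(i+3) - d_1 b_(i+2) + d_2 b_(i+1) - d_3 b_i = 0.
   As d_1 > 0, no root of unity of order 2 or 3 is a root of the characteristic
   polynomial d_0 X^3 - d_1 X^2 + d_2 X - d_3, so a solution with eventual period
   two or three is eventually constant. *)
Require Import Defs.
From HB Require Import structures.
From mathcomp Require Import all_boot all_order all_algebra.
From mathcomp Require Import boolp classical_sets.
From mathcomp Require Import zify ring lra.

Set Implicit Arguments.
Unset Strict Implicit.
Unset Printing Implicit Defensive.

Import Order.TTheory GRing.Theory Num.Theory.
Local Open Scope classical_set_scope.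
Local Open Scope ring_scope.

(** * Ideals, the residue field and powers of an ideal *)

Section Ideals.
Variable R : comNzRingType.
Implicit Types (m I : set R).

(** [J] is the ideal $\mathfrak m + Rx$. If no such [a] existed, [J] would omit 1, so maximality
    would force $J = \mathfrak m$, although $x \in J$. *)
Lemma maximal_inv m x : maximal_ideal m -> ~ m x -> exists a, m (1 - a * x).
Proof.
move=> [mI mmax] mx; apply: contrapT => noa.
pose J : set R := [set u | exists a, u - a * x \in m].
have [m0 m1 mD] := mI.
have JI : idealr_closed [in J].
  split; rewrite ?inE.
  - by exists 0; rewrite mul0r subr0.
  - by apply/negP; rewrite inE /J /= => -[a]; rewrite inE => am; apply: noa; exists a.
  - move=> c u v; rewrite !inE => -[a ua] [b vb].
    exists (c * a + b).
    by have := mD c _ _ ua vb; congr (_ \in m); ring.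
have mJ : m `<=` J by move=> u mu; exists 0; rewrite mul0r subr0 inE.
by apply: mx; rewrite -(mmax J JI mJ); exists 1; rewrite mul1r subrr.
Qed.

Lemma residue_field m : maximal_ideal m ->
  exists (k : fieldType) (pi : {rmorphism R -> k}),
    (forall y, exists x, pi x = y) /\ (forall x, pi x = 0 <-> m x).
Proof.
move=> mmax; have [mI _] := mmax.
pose I : idealr R := HB.pack [in m] (isIdealr.Build R [in m] mI).
have mE x : (x \in I) = (x \in m) by [].
pose Q : comNzRingType := {ideal_quot I}.
pose pi : {rmorphism R -> Q} := \pi_({ideal_quot I})%qT.
have pi_onto y : exists x, pi x = y.
  by exists (generic_quotient.repr y); exact: generic_quotient.reprK.
have pi0 x : (pi x == 0) = (x \in m).
  by rewrite -mE -(subr0 x) Quotient.idealrBE subr0 -(rmorph0 pi).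
(* The field structure asks for a total inverse that sends 0 to 0, hence the second clause. *)
have invP (y : Q) : exists z : Q, (y != 0 -> z * y = 1) /\ (y = 0 -> z = 0).
  have [->|y0] := eqVneq y 0; first by exists 0; split.
  have [x xy] := pi_onto y.
  have [a am] : exists a, m (1 - a * x).
    by apply: maximal_inv => // /mem_set; rewrite -pi0 xy (negPf y0).
  exists (pi a); split=> [_|/eqP]; last by rewrite (negPf y0).
  apply/esym/eqP; rewrite -subr_eq0 -xy -rmorphM -(rmorph1 pi) -rmorphB pi0.
  exact: mem_set.
have [inv invE] := choice invP.
pose k : fieldType := HB.pack (GRing.ComNzRing.sort Q)
  (GRing.ComNzRing_isField.Build Q (fun y => (invE y).1) ((invE 0).2 erefl)).
exists k, pi; split=> // x.
split=> [/eqP|mx]; first by rewrite pi0 inE.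
by apply/eqP; rewrite pi0 inE.
Qed.

Section Smul.
Variables (V : lmodType R) (I : set R) (N : set V).

Lemma smul_in a v : I a -> N v -> smul I N (a *: v).
Proof. by move=> Ia Nv; exists 1%N, (fun=> a), (fun=> v); rewrite big_ord1. Qed.

Lemma smul0 : smul I N 0.
Proof. by exists 0%N, (fun=> 0), (fun=> 0); split; [case|case|rewrite big_ord0]. Qed.

Lemma smulD x y : smul I N x -> smul I N y -> smul I N (x + y).
Proof.
move=> [p [a [v [Ia Nv ->]]]] [q [b [w [Ib Nw ->]]]].
exists (p + q)%N, (fun i => match split i with inl j => a j | inr j => b j end),
  (fun i => match split i with inl j => v j | inr j => w j end).
split=> [i|i|]; [by case: split|by case: split|].
rewrite big_split_ord /=; congr (_ + _); apply: eq_bigr => i _.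
  by case: split (unsplitK (inl i : 'I_p + 'I_q)) => // j [->].
by case: split (unsplitK (inr i : 'I_p + 'I_q)) => // j [->].
Qed.

Lemma smul_ind (P : V -> Prop) : P 0 -> (forall x y, P x -> P y -> P (x + y)) ->
  (forall a v, I a -> N v -> P (a *: v)) -> forall x, smul I N x -> P x.
Proof.
move=> P0 PD PZ x [n [a [v [Ia Nv ->]]]].
by elim/big_ind: _ => // i _; apply: PZ.
Qed.

End Smul.

Lemma idealX0 I n : idealX I n 0.
Proof. by case: n => // n; exact: (@smul0 R^o). Qed.

Lemma idealXD I n x y : idealX I n x -> idealX I n y -> idealX I n (x + y).
Proof. by case: n => // n; exact: (@smulD R^o). Qed.

Lemma idealXM I n r x : idealX I n x -> idealX I n (r * x).
Proof.
elim: n r x => // n IHn r x; move: x.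
apply: (@smul_ind R^o _ _ (fun x => idealX I n.+1 (r * x))).
- by rewrite mulr0; exact: (@smul0 R^o).
- by move=> x y; rewrite mulrDr; exact: (@smulD R^o).
- move=> a v Ia Xv; rewrite [r * _](_ : _ = a *: ((r * v) : R^o)).
    by apply: smul_in => //; apply: IHn.
  by rewrite /GRing.scale /=; ring.
Qed.

Lemma idealXB I n x y : idealX I n x -> idealX I n y -> idealX I n (x - y).
Proof. by move=> Xx Xy; rewrite -mulN1r; apply: idealXD => //; apply: idealXM. Qed.

Lemma idealX_sum I n (J : finType) (f : J -> R) :
  (forall j, idealX I n (f j)) -> idealX I n (\sum_j f j).
Proof.
by move=> Xf; elim/big_ind: _ => //; [apply: idealX0|move=> x y; apply: idealXD].
Qed.

Lemma idealX_mul I n x y : I x -> idealX I n y -> idealX I n.+1 (x * y).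
Proof. exact: (@smul_in R^o). Qed.

Lemma filtP I n r (x : 'rV[R]_r) :
  filt I (Posz n) x <-> forall j, idealX I n (x 0 j).
Proof.
split=> [|Xx].
  move: x; apply: (@smul_ind _ _ _ (fun x : 'rV__ => forall j, idealX I n (x 0 j))).
  - by move=> j; rewrite mxE; apply: idealX0.
  - by move=> x y Xx Xy j; rewrite mxE; apply: idealXD.
  - by move=> a v Xa _ j; rewrite mxE mulrC; apply: idealXM.
exists r, (fun j => x 0 j), (fun j => delta_mx 0 j); split=> //.
exact: row_sum_delta.
Qed.

(** A family of least size generating $\mathfrak m^n$ modulo $\mathfrak m^{n+1}$ works: a relation
    with a coefficient outside $\mathfrak m$, hence invertible modulo $\mathfrak m$, would make one
    generator redundant. *)
Lemma graded_basis m n : noetherian R -> maximal_ideal m ->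
  exists d (g : 'I_d -> R), [/\ forall i, idealX m n (g i),
    forall x, idealX m n x ->
      exists c : 'I_d -> R, idealX m n.+1 (x - \sum_i c i * g i) &
    forall c : 'I_d -> R, idealX m n.+1 (\sum_i c i * g i) -> forall i, m (c i)].
Proof.
move=> R_noeth mmax.
pose gens d (g : 'I_d -> R) := (forall i, idealX m n (g i)) /\
  forall x, idealX m n x ->
    exists c : 'I_d -> R, idealX m n.+1 (x - \sum_i c i * g i).
have ex_gens : exists d, `[< exists g : 'I_d -> R, gens d g >].
  have [|d [g gE]] := R_noeth (idealX m n).
    split=> [|a x y]; rewrite !inE; first exact: idealX0.
    by move=> Xx Xy; apply: idealXD => //; apply: idealXM.
  exists d; apply/asboolP; exists g; split=> [i|x].
    rewrite gE; exists (fun j => (j == i)%:R).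
    rewrite (bigD1 i) //= eqxx mul1r big1 ?addr0 // => j /negPf ->.
    by rewrite mul0r.
  by rewrite {1}gE => -[c ->]; exists c; rewrite subrr; apply: idealX0.
case: (ex_minnP ex_gens) => d /asboolP[g [Xg gX]] dmin.
exists d, g; split=> // c Xc i0; apply: contrapT => mc.
have [b mb] := maximal_inv mmax mc.
case: d g Xg gX dmin c Xc i0 mc mb => [|d] g Xg gX dmin c Xc i0 mc mb.
  by case: i0 {mc mb}.
suff : (d.+1 <= d)%N by rewrite ltnn.
apply: dmin; apply/asboolP; exists (fun j => g (lift i0 j)); split=> // x Xx.
have [c' Xc'] := gX x Xx.
(* Since $b c_{i_0} \equiv 1$ modulo $\mathfrak m$, the relation gives $g_{i_0} \equiv -b \sum_{j
   \ne i_0} c_j g_j$ modulo $\mathfrak m^{n+1}$; this is substituted into the expansion of [x]. *)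
exists (fun j => c' (lift i0 j) - c' i0 * b * c (lift i0 j)).
have := idealXD Xc' (idealXM (c' i0)
  (idealXD (idealXM b Xc) (idealX_mul mb (Xg i0)))).
congr (idealX m n.+1 _).
rewrite !(bigD1_ord i0) //=.
under [in RHS]eq_bigr do rewrite mulrBl -[_ * _ * g _]mulrA.
rewrite sumrB -mulr_sumr; ring.
Qed.

End Ideals.

(* [K] identifies [A / B] with [V], where [R] acts on [V] through [pi]. *)
Definition is_symbol (R : comNzRingType) (k : fieldType) (pi : R -> k)
    (F : lmodType R) (V : vectType k) (A B : set F) (K : F -> V) : Prop :=
  [/\ forall x y, A x -> A y -> A (x + y) /\ K (x + y) = K x + K y,
      forall r x, A x -> A (r *: x) /\ K (r *: x) = pi r *: K x,
      forall x, A x -> (K x = 0 <-> B x) &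
      forall v, exists2 x, A x & K x = v].

(** * Maps induced on subquotients and their ranks *)

Section Symbols.
Variables (R : comNzRingType) (k : fieldType) (pi : {rmorphism R -> k}).
Hypothesis pi_onto : forall y, exists x, pi x = y.
Implicit Types F : lmodType R.

Lemma symbol0 F (V : vectType k) (A B : set F) (K : F -> V) :
  is_symbol pi A B K -> A 0 /\ K 0 = 0.
Proof.
move=> [_ KZ _ /(_ 0)[x Ax _]].
by have := KZ 0 x Ax; rewrite rmorph0 !scale0r.
Qed.

Lemma symbolN F (V : vectType k) (A B : set F) (K : F -> V) x :
  is_symbol pi A B K -> A x -> A (- x) /\ K (- x) = - K x.
Proof.
by move=> [_ KZ _ _] Ax; have := KZ (-1) x Ax; rewrite rmorphN1 !scaleN1r.
Qed.

Section Induced.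
Variables (F F' : lmodType R) (V V' : vectType k).
Variables (A B : set F) (A' B' : set F') (K : F -> V) (K' : F' -> V').
Variable D : {linear F -> F'}.

(** The map $A/B \to A'/B'$ induced by [D], computed on a chosen lift along [K]. As [linfun] accepts
    any function, linearity can wait until [symbol_homE]. *)
Definition symbol_hom : 'Hom(V, V') :=
  linfun (fun v => K' (D (xget 0 [set x | A x /\ K x = v]))).

Hypotheses (symK : is_symbol pi A B K) (symK' : is_symbol pi A' B' K').
Hypotheses (DA : forall x, A x -> A' (D x)) (DB : forall x, B x -> B' (D x)).

(** Two lifts of one vector differ by an element of [B], which [D] sends into [B'], where [K']
    vanishes. This independence of the lift ([wd]) also yields linearity. *)
Lemma symbol_homE x : A x -> symbol_hom (K x) = K' (D x).
Proof.
have [KD KZ K0 K_onto] := symK; have [KD' KZ' K0' _] := symK'.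
pose s v := xget 0 [set x | A x /\ K x = v].
have sP v : A (s v) /\ K (s v) = v.
  rewrite /s; case: xgetP => [y -> //|noy].
  by have [y Ay Ky] := K_onto v; case: (noy y).
have wd y z : A y -> A z -> K y = K z -> K' (D y) = K' (D z).
  move=> Ay Az Kyz; have [ANz KNz] := symbolN symK Az.
  have [Ayz] := KD _ _ Ay ANz; rewrite KNz Kyz subrr => /(K0 _ Ayz).1 Byz.
  have /(K0' _ (DA Ayz)).2 := DB Byz.
  rewrite raddfB /=.
  have [AND KND] := symbolN symK' (DA Az); rewrite (KD' _ _ (DA Ay) AND).2 KND.
  by move/eqP; rewrite subr_eq0 => /eqP.
have lin : linear (fun v => K' (D (s v))).
  move=> a v w; have [r <-] := pi_onto a.
  have [[As Ks] [As' Ks']] := (sP v, sP w).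
  have [Ars Krs] := KZ r _ As; have [Arss Krss] := KD _ _ Ars As'.
  rewrite (wd _ (r *: s v + s w)) //; last 2 first.
  - by have [] := sP (pi r *: v + w).
  - by have [_ ->] := sP (pi r *: v + w); rewrite Krss Krs Ks Ks'.
  rewrite linearP /=.
  have [AZ' KZs] := KZ' r _ (DA As).
  by rewrite (KD' _ _ AZ' (DA As')).2 KZs.
pose f : {linear V -> V'} := HB.pack (fun v => K' (D (s v)))
  (GRing.isLinear.Build k V V' *:%R (fun v => K' (D (s v))) lin).
move=> Ax; rewrite /symbol_hom -/s (lfunE f) /=.
by have [As Ks] := sP (K x); apply: wd.
Qed.

End Induced.

(** The last hypothesis is exactness at the middle term, expressed on representatives. It makes the
    image of the first induced map the kernel of the second, and rank-nullity concludes. *)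
Lemma symbol_rank F2 F1 F0 (V2 V1 V0 : vectType k)
    (A2 B2 : set F2) (A1 B1 : set F1) (A0 B0 : set F0)
    (K2 : F2 -> V2) (K1 : F1 -> V1) (K0 : F0 -> V0)
    (D2 : {linear F2 -> F1}) (D1 : {linear F1 -> F0}) :
  is_symbol pi A2 B2 K2 -> is_symbol pi A1 B1 K1 -> is_symbol pi A0 B0 K0 ->
  (forall x, A2 x -> A1 (D2 x)) -> (forall x, B2 x -> B1 (D2 x)) ->
  (forall x, A1 x -> A0 (D1 x)) -> (forall x, B1 x -> B0 (D1 x)) ->
  (forall x, D1 (D2 x) = 0) ->
  (forall x, A1 x -> B0 (D1 x) -> exists y z, [/\ A2 y, B1 z & x = D2 y + z]) ->
  (\dim (limg (symbol_hom A2 K2 K1 D2)) + \dim (limg (symbol_hom A1 K1 K0 D1)) =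
   \dim {:V1})%N.
Proof.
move=> s2 s1 s0 DA2 DB2 DA1 DB1 DD ex.
rewrite -(limg_ker_dim (symbol_hom A1 K1 K0 D1) fullv) capfv.
congr (_ + _)%N; congr (\dim _); apply/vspaceP => v.
have hE2 := symbol_homE s2 s1 DA2 DB2; have hE1 := symbol_homE s1 s0 DA1 DB1.
have [_ _ KB0 _] := s0; have [KD1 _ KB1 onto1] := s1; have [_ _ _ onto2] := s2.
have [[A00 K00] [A10 K10]] := (symbol0 s0, symbol0 s1).
apply/idP/idP => [/memv_imgP[w _ ->]|].
  have [x Ax <-] := onto2 w.
  by rewrite hE2 // memv_ker hE1 ?DD ?K00 //; apply: DA2.
have [x Ax <-] := onto1 v.
rewrite memv_ker hE1 // => /eqP /(KB0 _ (DA1 _ Ax)).1 /(ex _ Ax)[y [z [Ay Bz xE]]].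
have [ANy _] := symbolN s1 (DA2 _ Ay).
(* The inclusion of [B1] in [A1] is not part of [is_symbol]; membership comes from $z = x - D_2
   y$. *)
have Az : A1 z by have [] := KD1 _ _ Ax ANy; rewrite xE addrAC subrr add0r.
rewrite xE (KD1 _ _ (DA2 _ Ay) Az).2 ((KB1 _ Az).2 Bz) addr0 -hE2 //.
by apply: memv_img; rewrite memvf.
Qed.

End Symbols.

(** * Graded pieces of the ring and of free modules as vector spaces over the residue field *)

Section GradedPieces.
Variables (R : comNzRingType) (m : set R) (k : fieldType) (pi : {rmorphism R -> k}).
Hypotheses (R_noeth : noetherian R) (m_max : maximal_ideal m).
Hypothesis pi_onto : forall y, exists x, pi x = y.
Hypothesis pi_ker : forall x, pi x = 0 <-> m x.

(** [K] takes the residues of the coefficients in a graded basis. By independence any valid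
    coefficients have the same residues ([cE]), so each clause reduces to exhibiting suitable
    coefficients. *)
Lemma symbol_idealX n : exists d (K : R^o -> 'rV[k]_d),
  is_symbol (F := R^o) pi (idealX m n) (idealX m n.+1) K.
Proof.
have [d [g [Xg g_gen g_free]]] := graded_basis n R_noeth m_max.
have /choice[c cP] x : exists c : 'I_d -> R, idealX m n x ->
    idealX m n.+1 (x - \sum_i c i * g i).
  (* Outside $\mathfrak m^n$ the zero family serves as a default value. *)
  have [Xx|nXx] := pselect (idealX m n x); last by exists (fun=> 0).
  by have [c cP] := g_gen x Xx; exists c.
have cE x c' : idealX m n x -> idealX m n.+1 (x - \sum_i c' i * g i) ->
    (\row_i pi (c x i)) = (\row_i pi (c' i)) :> 'rV[k]_d.
  move=> Xx Xc'; apply/rowP => i; rewrite !mxE; apply/eqP.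
  rewrite -subr_eq0 -rmorphB; apply/eqP; apply/pi_ker; move: i.
  apply: g_free; have := idealXB Xc' (cP _ Xx); congr (idealX m n.+1 _).
  under [RHS]eq_bigr do rewrite mulrBl.
  rewrite sumrB; ring.
exists d, (fun x => \row_i pi (c x i)); split.
- move=> x y Xx Xy; have Xxy := idealXD Xx Xy; split=> //.
  rewrite (cE _ (fun i => c x i + c y i)) //.
    by apply/rowP => i; rewrite !mxE rmorphD.
  have := idealXD (cP _ Xx) (cP _ Xy); congr (idealX m n.+1 _).
  under [in RHS]eq_bigr do rewrite mulrDl.
  rewrite big_split /=; ring.
- move=> r x Xx; have Xrx := idealXM r Xx; split=> //.
  rewrite (cE _ (fun i => r * c x i)) //.
    by apply/rowP => i; rewrite !mxE rmorphM.
  have := idealXM r (cP _ Xx); congr (idealX m n.+1 _).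
  under [in RHS]eq_bigr do rewrite -mulrA.
  by rewrite -mulr_sumr mulrBr.
- move=> x Xx; split=> [c0|Xx'].
    rewrite -[x](subrK (\sum_i c x i * g i)); apply: idealXD; first exact: cP.
    apply: idealX_sum => i; apply: idealX_mul => //.
    by apply/pi_ker; move/rowP: c0 => /(_ i); rewrite !mxE.
  rewrite (cE _ (fun=> 0)) //; first by apply/rowP => i; rewrite !mxE rmorph0.
  by rewrite big1 ?subr0 // => i _; rewrite mul0r.
- move=> v; have /choice[s sP] i : exists r, pi r = v 0 i := pi_onto _.
  have Xs : idealX m n (\sum_i s i * g i).
    by apply: idealX_sum => i; apply: idealXM.
  exists (\sum_i s i * g i) => //; rewrite (cE _ s) //.
    by apply/rowP => i; rewrite mxE.
  by rewrite subrr; apply: idealX0.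
Qed.

(** For $F = R^r$, the quotient $\mathfrak m^n F/\mathfrak m^{n+1} F$ is a sum of [r] copies of
    $\mathfrak m^n/\mathfrak m^{n+1}$, one for each row of the matrix. *)
Definition coordwise d (K : R^o -> 'rV[k]_d) r (x : 'rV[R]_r) : 'M[k]_(r, d) :=
  \matrix_(j, i) K (x 0 j) 0 i.

Lemma symbol_filt n d (K : R^o -> 'rV[k]_d) r :
  is_symbol (F := R^o) pi (idealX m n) (idealX m n.+1) K ->
  is_symbol pi (filt m (Posz n)) (filt m (Posz n.+1))
    (coordwise K (r := r) : _ -> 'M[k]_(r, d)).
Proof.
move=> [KD KZ K0 K_onto]; split.
- move=> x y /filtP Xx /filtP Xy; split.
    by apply/filtP => j; rewrite mxE; apply: idealXD.
  by apply/matrixP => j i; rewrite !mxE (KD _ _ (Xx j) (Xy j)).2 mxE.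
- move=> a x /filtP Xx; split.
    by apply/filtP => j; rewrite mxE; apply: idealXM.
  apply/matrixP => j i; rewrite !mxE.
  by have [_ /rowP/(_ i)] := KZ a _ (Xx j); rewrite !mxE.
- move=> x /filtP Xx; split=> [/matrixP Kx|/filtP Xx'].
    apply/filtP => j; apply/(K0 _ (Xx j))/rowP => i.
    by have := Kx j i; rewrite !mxE.
  apply/matrixP => j i; rewrite !mxE.
  by have /(K0 _ (Xx j)) -> := Xx' j; rewrite mxE.
- move=> v.
  have /choice[s sP] j : exists x, idealX m n x /\ K x = row j v.
    by have [x Xx Kx] := K_onto (row j v); exists x.
  exists (\row_j s j); first by apply/filtP => j; rewrite mxE; case: (sP j).
  by apply/matrixP => j i; rewrite !mxE (sP j).2 mxE.
Qed.

End GradedPieces.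

(** The images of the basis vectors have coordinates in $\mathfrak m$, so each coordinate of [D x]
    is a sum of products of elements of $\mathfrak m$ and $\mathfrak m^n$. *)
Lemma filt_linear (R : comNzRingType) (m : set R) n p q
    (D : {linear 'rV[R]_p -> 'rV[R]_q}) :
  range D `<=` smul m setT ->
  forall x, filt m (Posz n) x -> filt m (Posz n.+1) (D x).
Proof.
move=> Dm x /filtP Xx; apply/filtP => j.
rewrite (row_sum_delta x) linear_sum summxE; apply: idealX_sum => i.
rewrite linearZ /= mxE mulrC.
have : smul m setT (D (delta_mx 0 i)) by apply: Dm; exists (delta_mx 0 i).
move: (D _); apply: (@smul_ind _ _ _ _ (fun y : 'rV_q => idealX m n.+1 (y 0 j * x 0 i))).
- by rewrite mxE mul0r; apply: idealX0.
- by move=> y z; rewrite mxE mulrDl; apply: idealXD.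
- by move=> a v ma _; rewrite mxE -mulrA mulrCA; apply: idealXM; apply: idealX_mul.
Qed.

(** * The recurrence of the Betti numbers, from exact strands *)

Section Recurrence.
Variables (R : comNzRingType) (m : set R) (M : lmodType R) (F : free_resolution M).

(** This is the strand $j = a + i + 1$. The index [Posz a - 1] stays an integer: for $a = 0$ it is
    negative and leaves [y] unconstrained. *)
Lemma strand_exact i a x : gr_homology_eq0 m F i.+1 ->
  filt m (Posz a) x -> filt m (Posz a.+2) (diff F i x) ->
  exists y z, [/\ filt m (Posz a - 1) y, filt m (Posz a.+1) z &
                  x = diff F i.+1 y + z].
Proof.
move=> ex Xx XDx; have := ex (Posz (a + i.+1)) x.
rewrite /gr_cycle /gr_boundary PoszD addrK -PoszD addn2 -[1]/(Posz 1) -PoszD addn1.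
by move=> /(_ (conj Xx XDx)) [y [z yz]]; exists y, z.
Qed.

Lemma diff_diff i x : diff F i (diff F i.+1 x) = 0.
Proof.
have : range (diff F i.+1) (diff F i.+1 x) by exists x.
by rewrite -diff_exact.
Qed.

Hypotheses (R_noeth : noetherian R) (m_max : maximal_ideal m).
Hypotheses (m4 : idealX m 4 = [set 0]) (m3 : idealX m 3 <> [set 0]).
Hypothesis F_min : minimal m F.

Lemma betti_recurrence L : (forall i, (L <= i)%N -> gr_homology_eq0 m F i) ->
  exists d : nat -> nat, (0 < d 1)%N /\ forall i, (L <= i.+1)%N ->
    (d 0 * betti F i.+4 + d 2 * betti F i.+2 =
     d 1 * betti F i.+3 + d 3 * betti F i.+1)%N.
Proof.
move=> ex; have [k [pi [pi_onto pi_ker]]] := residue_field m_max.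
have /choice[dK dKP] n : exists dK : {d & R^o -> 'rV[k]_d},
    is_symbol (F := R^o) pi (idealX m n) (idealX m n.+1) (projT2 dK).
  have [d [K KP]] := symbol_idealX R_noeth m_max pi_onto pi_ker n.
  by exists (existT _ d K).
pose d n := projT1 (dK n); pose K n : R^o -> 'rV[k]_(d n) := projT2 (dK n).
have KP n : is_symbol (F := R^o) pi (idealX m n) (idealX m n.+1) (K n) := dKP n.
(* If $d_1 = 0$ then $\mathfrak m = \mathfrak m^2$, whence $\mathfrak m^3 = \mathfrak m^4 = 0$. *)
have d1 : (0 < d 1)%N.
  rewrite lt0n; apply/eqP => d10; apply: m3.
  have X12 : idealX m 1 `<=` idealX m 2.
    move=> x Xx; have [_ _ K0 _] := KP 1%N; apply/(K0 x Xx).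
    by apply/rowP => -[j jd]; exfalso; move: jd; rewrite d10.
  have XS n : idealX m n `<=` idealX m n.+1 -> idealX m n.+1 `<=` idealX m n.+2.
    move=> sub; apply: (@smul_ind R R^o _ _ (idealX m n.+2)).
    - exact: idealX0.
    - exact: (@idealXD R m n.+2).
    - by move=> a v ma Xv; apply: idealX_mul => //; apply: sub.
  apply/seteqP; split=> [x /(XS _ (XS _ X12))|_ ->]; first by rewrite m4.
  exact: idealX0.
have d4 : d 4 = 0%N.
  apply/eqP; rewrite -leqn0 leqNgt; apply/negP => d4.
  have [_ _ _ /(_ (const_mx 1))[x]] := KP 4.
  rewrite m4 => ->; rewrite (symbol0 (KP 4)).2 => /rowP/(_ (Ordinal d4)).
  by rewrite !mxE => /eqP; rewrite eq_sym oner_eq0.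
pose C n r : 'rV[R]_r -> 'M[k]_(r, d n) := coordwise (K n) (r := r).
have CP n r : is_symbol pi (filt m (Posz n)) (filt m (Posz n.+1)) (C n r).
  exact: symbol_filt (KP n).
have DX i n := filt_linear (n := n) (@F_min i).
(* The strand differential $\mathfrak m^a F_{i+1}/\mathfrak m^{a+1} F_{i+1} \to \mathfrak m^{a+1}
   F_i/\mathfrak m^{a+2} F_i$. *)
pose h i a := symbol_hom (filt m (Posz a)) (C a _) (C a.+1 _) (diff F i).
pose rk i a := \dim (limg (h i a)).
have rkS i a : (L <= i.+1)%N -> (rk i.+1 a + rk i a.+1 = betti F i.+1 * d a.+1)%N.
  move=> Li; transitivity (\dim {:'M[k]_(rank F i.+1, d a.+1)}).
    apply: (symbol_rank pi_onto (CP a _) (CP a.+1 _) (CP a.+2 _)).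
    - exact: DX.
    - exact: DX.
    - exact: DX.
    - exact: DX.
    - exact: diff_diff.
    - move=> x Xx XDx; have [y [z]] := strand_exact (ex _ Li) Xx XDx.
      by rewrite -addn1 PoszD addrK => yz; exists y, z.
  by rewrite dimvf dim_matrix.
(* At $a = 0$ the differential is injective: a cycle is $\partial y + z$ with $z \in \mathfrak m
   F_{i+1}$, and $\partial y \in \mathfrak m F_{i+1}$ by minimality. *)
have rk0 i : (L <= i.+1)%N -> (rk i 0%N = betti F i.+1 * d 0)%N.
  move=> Li; rewrite /rk limg_dim_eq ?dimvf ?dim_matrix // capfv.
  apply/eqP; rewrite -subv0; apply/subvP => v; rewrite memv_ker memv0.
  have [_ _ K0 /(_ v)[x Xx <-]] := CP 0%N (rank F i.+1).
  rewrite (symbol_homE pi_onto (CP _ _) (CP _ _)) //; try exact: DX.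
  move=> /eqP; have [_ _ K1 _] := CP 1%N (rank F i).
  move=> /(K1 _ (DX _ _ _ Xx)).1 /(strand_exact (ex _ Li) Xx)[y [z [_ Xz xE]]].
  apply/eqP/(K0 _ Xx); rewrite xE; apply/filtP => j; rewrite mxE.
  apply: idealXD; last by move/filtP: Xz.
  by apply/filtP: j; apply: DX; apply/filtP.
(* The target is a quotient of $\mathfrak m^4 F_i = 0$. *)
have rk3 i : rk i 3 = 0%N.
  apply/eqP; rewrite -leqn0 (leq_trans (dimvS (subvf _))) //.
  by rewrite dimvf dim_matrix d4 mulr0.
exists d; split=> // i Li.
(* Both sides equal [rk i.+3 0 + rk i.+2 1 + rk i.+1 2]. *)
by rewrite !(mulnC (d _)) -rk0 -?rkS ?rk3 ?addn0 ?addnA //; lia.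
Qed.

End Recurrence.

(** * Solutions of the recurrence with period two or three *)

Section Periodicity.
Variables (b : nat -> nat) (L c0 c1 c2 c3 : nat).
Hypothesis c1_gt0 : (0 < c1)%N.
Hypothesis b_rec : forall i, (L <= i)%N ->
  (c0 * b i.+3 + c2 * b i.+1 = c1 * b i.+2 + c3 * b i)%N.

Lemma periodic_from_mul N p t i : periodic_from b N p -> (N <= i)%N ->
  b (i + t * p)%N = b i.
Proof.
move=> [_ per] Ni; elim: t => [|t IHt]; first by rewrite addn0.
by rewrite mulSn addnCA addnC per // -?IHt ?addnA //; lia.
Qed.

(** Shifting by [L] periods moves any index past [L], so constancy there descends to all indices
    from [N] on. The same [N] must be kept, since [eventually_periodic] compares periods from a
    common starting point. *)
Lemma periodic_from1 N p : periodic_from b N p ->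
  (forall i, (N <= i)%N -> (L <= i)%N -> b i.+1 = b i) -> periodic_from b N 1.
Proof.
move=> per tail; have [p_gt0 _] := per; split=> // i Ni.
rewrite -(periodic_from_mul L per Ni).
rewrite -(periodic_from_mul L per (i := (i + 1)%N)); last lia.
by rewrite addn1 addSn tail //; nia.
Qed.

(** Subtracting two consecutive recurrences gives $(c_0 + c_1 + c_2 + c_3)(b_{i+1} - b_i) = 0$, and
    $c_1 > 0$. Up to sign, the factor is the characteristic polynomial at $-1$. *)
Lemma periodic2_const N : periodic_from b N 2 -> periodic_from b N 1.
Proof.
move=> per; apply: periodic_from1 (per) _ => i Ni Li; have [_ perE] := per.
have := b_rec Li; have := b_rec (leqW Li).
have := perE i Ni; have := perE i.+1 (leqW Ni); have := perE i.+2 (leqW (leqW Ni)).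
rewrite !addn2 => -> -> ->; nia.
Qed.

(** For consecutive values $x, y, z$ and [p], [q] as below, the recurrences over one period say that
    $px + qy$, $py + qz$ and $pz + qx$ all equal $c_1(x + y + z)$. Their differences are two linear
    relations between $y - x$ and $z - y$, of determinant $p^2 - pq + q^2$. *)
Lemma periodic3_const N : periodic_from b N 3 -> periodic_from b N 1.
Proof.
move=> per; apply: periodic_from1 (per) _ => i Ni Li; have [_ perE] := per.
have := b_rec Li; have := b_rec (leqW Li); have := b_rec (leqW (leqW Li)).
have := perE i Ni; have := perE i.+1 (leqW Ni); have := perE i.+2 (leqW (leqW Ni)).
rewrite !addn3 => -> -> ->.
move: (b i) (b i.+1) (b i.+2) => x y z.
move=> /(congr1 Posz) E1 /(congr1 Posz) E2 /(congr1 Posz) E3.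
rewrite !(PoszD, PoszM) in E1 E2 E3.
(* For a primitive cube root of unity [w], the characteristic polynomial takes
   the value [p + q w] at [w], of norm [p^2 - p q + q^2]. *)
pose p : int := c0%:Z - c3%:Z + c1%:Z; pose q : int := c2%:Z + c1%:Z.
pose s : int := y%:Z - x%:Z.
have qs : (p - q) * (z%:Z - y%:Z) = q * s by rewrite /p /q /s; lra.
have ps : p * s + q * (z%:Z - y%:Z) = 0 by rewrite /p /q /s; lra.
(* Eliminating $z - y$ leaves the determinant times [s]; the factor 4 turns it into a sum of
   squares, positive since $q > 0$. *)
have : ((2 * p - q) ^+ 2 + 3 * q ^+ 2) * s = 0.
  rewrite (_ : _ * s = 4 * ((p - q) * (p * s + q * (z%:Z - y%:Z))
    - q * ((p - q) * (z%:Z - y%:Z) - q * s))); last ring.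
  by rewrite ps qs; ring.
have q_gt0 : (0 < q)%R by rewrite /q; lia.
move/eqP; rewrite mulf_eq0 => /orP[/eqP H|]; last by rewrite subr_eq0 => /eqP[].
suff : (0 < (2 * p - q) ^+ 2 + 3 * q ^+ 2)%R by rewrite H ltxx.
by rewrite ltr_wpDl ?sqr_ge0 // pmulr_rgt0 ?exprn_gt0.
Qed.

End Periodicity.

Theorem theoremA (R : comNzRingType) (m : set R)
  (R_noeth : noetherian R) (R_local : local_ring m)
  (m4 : idealX m 4 = [set 0]) (m3 : idealX m 3 <> [set 0])
  (M : lmodType R) (M_fg : fin_gen M)
  (F : free_resolution M) (F_min : minimal m F)
  (F_lin : eventually_linear m F)
  (ExtM : exists N : nat, forall i : nat, (N <= i)%N -> Ext_eq0 F R^o i) :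
  ~ (eventually_periodic (betti F) 2 \/ eventually_periodic (betti F) 3).
Proof.
have [L [_ [ex _]]] := F_lin; have [m_max _] := R_local.
have [d [d1 b_rec]] := betti_recurrence R_noeth m_max m4 m3 F_min ex.
(* [betti_recurrence] has lowest index [i.+1]; starting at [L.+1] excludes index 0. *)
have rec i : (L.+1 <= i)%N -> (d 0 * betti F i.+3 + d 2 * betti F i.+1 =
    d 1 * betti F i.+2 + d 3 * betti F i)%N.
  by case: i => // i Li; apply: b_rec; apply: ltnW.
case=> -[N [per least]].
- by have := least _ (periodic2_const d1 rec per).
- by have := least _ (periodic3_const d1 rec per).
Qed.
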